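(* Let $\mathcal{T}$ be a Lawvere theory, $\mathcal{V}$ a variety whose Lawvere theory $\mathcal{T}_{\mathcal{V}}$ is commutative, and $\Phi\colon\mathcal{T}\to\mathcal{T}_{\mathcal{V}}$ a morphism of Lawvere theories. Then the following hold. 1. The functor $N_\Phi=\bigl(\mathcal{V}\xrightarrow{N}\mathsf{Coalg}(\mathcal{T}_{\mathcal{V}},\mathcal{V})\xrightarrow{{}^{\mathcal{V}}\Phi}\mathsf{Coalg}(\mathcal{T},\mathcal{V})\bigr)$ is full and faithful. 2. $N_\Phi(F_{\mathcal{V}}X)=V_\Phi(X)$ for each set $X$, and $\|-\|\circ N_\Phi=\mathrm{id}_{\mathcal{V}}$. 3. The assignment $\Phi\mapsto N_\Phi$ defines an essentially bijective correspondence between morphisms of Lawvere theories $\Phi\colon\mathcal{T}\to\mathcal{T}_{\mathcal{V}}$ and functors $S\colon\mathcal{V}\to\mathsf{Coalg}(\mathcal{T},\mathcal{V})$ with $\|-\|\circ S=\mathrm{id}_{\mathcal{V}}$. 4. For any $\mathcal{V}$-algebra $A$, the $\mathcal{T}$-representable functor corresponding to $N_\Phi A$ is $R_{N_\Phi A}=\bigl(\mathcal{V}\xrightarrow{[A,-]}\mathcal{V}\xrightarrow{\Phi^*}\mathsf{Alg}\,\mathcal{T}\bigr)$. The co-operation $\sigma_{N_\Phi A}$ corresponding to $\sigma\in\mathcal{T}(n,1)$ is explicitly given by $\sigma_{N_\Phi A}=\Phi(\sigma)^{n\cdot A}\circ\langle\nu_1,\dots,\nu_n\rangle$.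
   Context: A Lawvere theory is a category $\mathcal{T}$ with finite products and with a countable set of objects $T_0,T_1,T_2,\dots$ (written $0,1,2,\dots$) such that each $T_n$ is a specified $n$-fold power of $T_1$; morphisms are functors preserving finite products (and the specified powers). $\mathcal{T}$ is commutative if $\sigma\circ\tau^n=\tau\circ\sigma^m\colon n\times m\to1$ for all $\sigma\in\mathcal{T}(n,1)$, $\tau\in\mathcal{T}(m,1)$. $\mathsf{Alg}\,\mathcal{T}$ is the category of finite product preserving functors $\mathcal{T}\to\mathrm{Set}$, with forgetful functor $|-|$ evaluation at $T_1$. A variety $\mathcal{V}$ is concretely equivalent to $\mathsf{Alg}\,\mathcal{T}_{\mathcal{V}}$, where $\mathcal{T}_{\mathcal{V}}$ is the dual of the full subcategory of $\mathcal{V}$ spanned by the free algebras $F_{\mathcal{V}}n$, $n\in\mathbb{N}$; $F_{\mathcal{V}}\colon\mathrm{Set}\to\mathcal{V}$ is the free algebra functor. For $\Phi\colon\mathcal{T}\to\mathcal{T}_{\mathcal{V}}$, $\Phi^*\colon\mathcal{V}\to\mathsf{Alg}\,\mathcal{T}$ is precomposition with $\Phi$. For $s\in\mathcal{T}_{\mathcal{V}}(n,1)$, $s^B\colon B^n\to B$ is the interpretation of $s$ in $B$. $\mathsf{Coalg}(\mathcal{T},\mathcal{V})$ is the category of finite coproduct preserving functors $\mathsf{A}\colon\mathcal{T}^{\mathrm{op}}\to\mathcal{V}$ and natural transformations, with forgetful functor $\|-\|$ to $\mathcal{V}$ given by evaluation at $T_1$. For $\sigma\in\mathcal{T}(n,1)$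 the co-operation is $\sigma_{\mathsf{A}}=\mathsf{A}(\sigma)\colon A\to n\cdot A$, with $A=\|\mathsf{A}\|$ and $n\cdot A$ the $n$-fold copower with injections $\nu_1,\dots,\nu_n\colon A\to n\cdot A$; $\langle\nu_1,\dots,\nu_n\rangle\colon A\to(n\cdot A)^n$ has components $\nu_k$. A functor $R\colon\mathcal{V}\to\mathsf{Alg}\,\mathcal{T}$ is $\mathcal{T}$-representable if $|-|\circ R=\mathcal{V}(A,-)$ for some $A$; coalgebras $\mathsf{A}$ correspond to $\mathcal{T}$-representable functors $R_{\mathsf{A}}$, where $R_{\mathsf{A}}(C)=\mathcal{V}(\mathsf{A}(-),C)$. The functor ${}^{\mathcal{V}}\Phi\colon\mathsf{Coalg}(\mathcal{T}_{\mathcal{V}},\mathcal{V})\to\mathsf{Coalg}(\mathcal{T},\mathcal{V})$ is precomposition with $\Phi^{\mathrm{op}}$. $V_\Phi(1)$ is the $\mathcal{T}$-coalgebra $\mathcal{T}^{\mathrm{op}}\xrightarrow{\Phi^{\mathrm{op}}}\mathcal{T}_{\mathcal{V}}^{\mathrm{op}}\hookrightarrow\mathcal{V}$ with underlying algebra $F_{\mathcal{V}}1$, and $V_\Phi(X)=X\cdot V_\Phi(1)$ is its $X$-fold copower in $\mathsf{Coalg}(\mathcal{T},\mathcal{V})$, defining a functor $V_\Phi\colon\mathrm{Set}\to\mathsf{Coalg}(\mathcal{T},\mathcal{V})$ with $\|-\|\circ V_\Phi=F_{\mathcal{V}}$. Since $\mathcal{T}_{\mathcal{V}}$ is commutative,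 each hom-set $\mathcal{V}(A,B)$ is a subalgebra $[A,B]$ of the power $B^{|A|}$, and $[-,-]$ is the internal hom of a monoidal closed structure on $\mathcal{V}$. $N\colon\mathcal{V}\to\mathsf{Coalg}(\mathcal{T}_{\mathcal{V}},\mathcal{V})$ is the functor sending $A$ to the $\mathcal{T}_{\mathcal{V}}$-coalgebra $NA$ with underlying algebra $A$ whose $\mathcal{T}_{\mathcal{V}}$-representable functor is $[A,-]\colon\mathcal{V}\to\mathcal{V}$; it satisfies $\|-\|\circ N=\mathrm{id}_{\mathcal{V}}$. Equalities of functors are understood up to natural isomorphism. *)

(* Defs.v *)
From mathcomp Require Import all_boot matrix.
From mathcomp Require Import boolp.

Set Implicit Arguments.
Unset Strict Implicit.
Unset Printing Implicit Defensive.

Declare Scope cat_scope.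
Delimit Scope cat_scope with cat.
Local Open Scope cat_scope.

Record cat_on (O : Type) := CatOn {
  hom : O -> O -> Type;
  idm : forall a, hom a a;
  ccomp : forall a b c, hom b c -> hom a b -> hom a c;
  ccompA : forall a b c d (h : hom c d) (g : hom b c) (f : hom a b),
    ccomp h (ccomp g f) = ccomp (ccomp h g) f;
  ccomp1m : forall a b (f : hom a b), ccomp (idm b) f = f;
  ccompm1 : forall a b (f : hom a b), ccomp f (idm a) = f
}.

Record category := Category { ob :> Type; cat_str :> cat_on ob }.

Notation "g ∘ f" := (ccomp g f) (at level 40, left associativity) : cat_scope.

Definition op_str (C : category) : cat_on C.
Proof.
refine (@CatOn C (fun a b => hom C b a) (fun a => idm C a)
  (fun a b c g f => f ∘ g) _ _ _).
- by move=> *; rewrite ccompA.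
- by move=> *; rewrite ccompm1.
- by move=> *; rewrite ccomp1m.
Defined.

Definition op_cat (C : category) : category := Category (op_str C).

Definition is_iso (C : category) (a b : C) (f : hom C a b) : Prop :=
  exists g : hom C b a, g ∘ f = idm C a /\ f ∘ g = idm C b.

Definition is_product (C : category) (I : Type) (X : I -> C) (P : C)
    (p : forall i, hom C P (X i)) : Prop :=
  forall (Z : C) (f : forall i, hom C Z (X i)),
    exists! h : hom C Z P, forall i, p i ∘ h = f i.

Definition is_coproduct (C : category) (I : Type) (X : I -> C) (P : C)
    (q : forall i, hom C (X i) P) : Prop :=
  forall (Z : C) (f : forall i, hom C (X i) Z),
    exists! h : hom C P Z, forall i, h ∘ q i = f i.

Definition tupling (C : category) (I : Type) (X : I -> C) (P : C)
    (p : forall i, hom C P (X i)) (HP : is_product p)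
    (Z : C) (f : forall i, hom C Z (X i)) : hom C Z P :=
  projT1 (cid (HP Z f)).

Definition cotupling (C : category) (I : Type) (X : I -> C) (P : C)
    (q : forall i, hom C (X i) P) (HP : is_coproduct q)
    (Z : C) (f : forall i, hom C (X i) Z) : hom C P Z :=
  projT1 (cid (HP Z f)).

Lemma tuplingE (C : category) (I : Type) (X : I -> C) (P : C)
    (p : forall i, hom C P (X i)) (HP : is_product p)
    (Z : C) (f : forall i, hom C Z (X i)) i :
  p i ∘ tupling HP f = f i.
Proof. by rewrite /tupling; case: cid => h [hE hu]; apply: hE. Qed.

Lemma cotuplingE (C : category) (I : Type) (X : I -> C) (P : C)
    (q : forall i, hom C (X i) P) (HP : is_coproduct q)
    (Z : C) (f : forall i, hom C (X i) Z) i :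
  cotupling HP f ∘ q i = f i.
Proof. by rewrite /cotupling; case: cid => h [hE hu]; apply: hE. Qed.

Lemma coproduct_ext (C : category) (I : Type) (X : I -> C) (P : C)
    (q : forall i, hom C (X i) P) (HP : is_coproduct q)
    (Z : C) (g h : hom C P Z) :
  (forall i, g ∘ q i = h ∘ q i) -> g = h.
Proof.
move=> e; have [k [_ ku]] := HP Z (fun i => h ∘ q i).
by rewrite -(ku g e) -(ku h (fun=> erefl)).
Qed.

Record functor (C D : category) := Functor {
  fobj :> C -> D;
  fmap : forall a b, hom C a b -> hom D (fobj a) (fobj b);
  fmap1 : forall a, fmap (idm C a) = idm D (fobj a);
  fmapM : forall a b c (g : hom C b c) (f : hom C a b),
    fmap (g ∘ f) = fmap g ∘ fmap f
}.

Record natural (C D : category) (F G : functor C D) := Natural {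
  ncomp :> forall a, hom D (F a) (G a);
  ncompP : forall a b (f : hom C a b), ncomp b ∘ fmap F f = fmap G f ∘ ncomp a
}.

Lemma natural_eq (C D : category) (F G : functor C D) (u v : natural F G) :
  (forall a, u a = v a) -> u = v.
Proof.
case: u v => u up [v vp] /= e.
have {}e : u = v by apply: functional_extensionality_dep.
by subst v; rewrite (Prop_irrelevance up vp).
Qed.

Definition nat_iso (C D : category) (F G : functor C D) : Prop :=
  exists u : natural F G, forall a, is_iso (u a).

Definition functor_id (C : category) : functor C C :=
  @Functor C C (fun a => a) (fun _ _ f => f) (fun=> erefl)
    (fun _ _ _ _ _ => erefl).

Definition functor_comp (B C D : category) (G : functor C D) (F : functor B C) :
  functor B D.
Proof.
refine (@Functor B D (fun a => G (F a)) (fun a b f => fmap G (fmap F f)) _ _).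
- by move=> a; rewrite !fmap1.
- by move=> *; rewrite !fmapM.
Defined.

Definition functor_op (C D : category) (F : functor C D) :
    functor (op_cat C) (op_cat D) :=
  @Functor (op_cat C) (op_cat D) F (fun a b f => fmap F (f : hom C b a))
    (fmap1 F) (fun _ _ _ g f => fmapM F f g).

Definition faithful (C D : category) (F : functor C D) : Prop :=
  forall a b (f g : hom C a b), fmap F f = fmap F g -> f = g.

Definition full (C D : category) (F : functor C D) : Prop :=
  forall a b (g : hom D (F a) (F b)), exists f : hom C a b, fmap F f = g.

Definition preserves_finite_products (C D : category) (F : functor C D) : Prop :=
  forall (n : nat) (X : 'I_n -> C) (P : C) (p : forall i, hom C P (X i)),
    is_product p -> is_product (fun i => fmap F (p i)).

Definition preserves_finite_coproducts (C D : category) (F : functor C D) : Prop :=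
  forall (n : nat) (X : 'I_n -> C) (P : C) (q : forall i, hom C (X i) P),
    is_coproduct q -> is_coproduct (fun i => fmap F (q i)).

Definition nat_id (C D : category) (F : functor C D) : natural F F.
Proof.
refine (@Natural C D F F (fun a => idm D (F a)) _).
by move=> a b f; rewrite ccomp1m ccompm1.
Defined.

Definition nat_comp (C D : category) (F G H : functor C D)
    (v : natural G H) (u : natural F G) : natural F H.
Proof.
refine (@Natural C D F H (fun a => v a ∘ u a) _).
by move=> a b f; rewrite -ccompA ncompP ccompA ncompP -ccompA.
Defined.

Definition functor_cat_str (C D : category) : cat_on (functor C D).
Proof.
refine (@CatOn (functor C D) (@natural C D) (@nat_id C D) (@nat_comp C D) _ _ _).
- by move=> *; apply: natural_eq => a /=; rewrite ccompA.
- by move=> *; apply: natural_eq => a /=; rewrite ccomp1m.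
- by move=> *; apply: natural_eq => a /=; rewrite ccompm1.
Defined.

Definition functor_cat (C D : category) : category :=
  Category (functor_cat_str C D).

Definition full_sub (C : category) (P : C -> Prop) : category :=
  @Category {a : C | P a}
    (@CatOn {a : C | P a} (fun a b => hom C (sval a) (sval b))
       (fun a => idm C (sval a)) (fun a b c g f => g ∘ f)
       (fun a b c d => @ccompA _ C (sval a) (sval b) (sval c) (sval d))
       (fun a b => @ccomp1m _ C (sval a) (sval b))
       (fun a b => @ccompm1 _ C (sval a) (sval b))).

Definition SET : category :=
  @Category Type (@CatOn Type (fun X Y => X -> Y) (fun X x => x)
    (fun X Y Z g f x => g (f x)) (fun _ _ _ _ _ _ _ => erefl)
    (fun _ _ _ => erefl) (fun _ _ _ => erefl)).

(* The object T_n is the number n.  Since every object is a specified power of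
   1, all finite products exist (T_n x T_m is T_(n + m)).  T_1 is the 1-fold
   power of itself through the identity. *)
Record lawvere := Lawvere {
  lstr : cat_on nat;
  lpi : forall n, 'I_n -> hom lstr n 1;
  lpow : forall n,
    @is_product (Category lstr) 'I_n (fun=> 1) n (fun k => lpi k);
  lpi1 : @lpi 1 ord0 = idm lstr 1
}.

Arguments lpow : clear implicits.

Definition lawvere_cat (T : lawvere) : category := Category (lstr T).
Coercion lawvere_cat : lawvere >-> category.

Definition ltuple (T : lawvere) (m n : nat) (f : 'I_n -> hom T m 1) : hom T m n :=
  tupling (lpow T n) f.

Record lawvere_mor (T T' : lawvere) := LawvereMor {
  lmap :> forall n m, hom T n m -> hom T' n m;
  lmap1 : forall n, lmap (idm T n) = idm T' n;
  lmapM : forall n m p (t : hom T m p) (s : hom T n m),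
    lmap (t ∘ s) = lmap t ∘ lmap s;
  lmap_pi : forall n (k : 'I_n), lmap (lpi T k) = lpi T' k
}.

Definition lmor_functor (T T' : lawvere) (Phi : lawvere_mor T T') : functor T T' :=
  @Functor T T' (fun n => n) (lmap Phi) (lmap1 Phi) (lmapM Phi).

(* n x m is T_(n * m), with the (i, j)-th projection indexed by
   mxvec_index i j; lrow i and lcol j select the i-th row T_m and the j-th
   column T_n of the resulting n x m array of variables. *)
Definition lrow (T : lawvere) (n m : nat) (i : 'I_n) : hom T (n * m)%N m :=
  ltuple (fun j : 'I_m => lpi T (mxvec_index i j)).

Definition lcol (T : lawvere) (n m : nat) (j : 'I_m) : hom T (n * m)%N n :=
  ltuple (fun i : 'I_n => lpi T (mxvec_index i j)).

Definition commutative_theory (T : lawvere) : Prop :=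
  forall (n m : nat) (s : hom T n 1) (t : hom T m 1),
    s ∘ ltuple (fun i : 'I_n => t ∘ lrow T m i) =
    t ∘ ltuple (fun j : 'I_m => s ∘ lcol T n j).

Lemma powers_preserve (T : lawvere) (D : category) (G : functor (op_cat T) D) :
  (forall n, @is_coproduct D 'I_n (fun=> G 1) (G n)
     (fun k => @fmap _ _ G 1 n (lpi T k))) ->
  preserves_finite_coproducts G.
Proof.
move=> HG n X P q HP.
pose K := {i : 'I_n & 'I_(X i)}.
have HT (c : nat) : @is_coproduct (op_cat T) 'I_c (fun=> 1) c (fun k => lpi T k).
  exact: (lpow T c).
pose e (k : K) : hom (op_cat T) 1 (X (tag k)) := lpi T (tagged k).
pose u : hom (op_cat T) #|{: K}| P :=
  cotupling (HT #|{: K}|) (fun r => q (tag (enum_val r)) ∘ e (enum_val r)).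
pose v : hom (op_cat T) P #|{: K}| :=
  cotupling HP (fun i => cotupling (HT (X i))
    (fun j => lpi T (enum_rank (Tagged (fun i => 'I_(X i)) j : K)))).
have uE (k : K) : u ∘ (lpi T (enum_rank k) : hom (op_cat T) 1 #|{: K}|) =
    q (tag k) ∘ e k.
  rewrite [LHS](cotuplingE (HT #|{: K}|)).
  by rewrite (congr1 (fun k => q (tag k) ∘ e k) (enum_rankK k)).
have vE i (j : 'I_(X i)) : v ∘ q i ∘ (lpi T j : hom (op_cat T) 1 (X i)) =
    lpi T (enum_rank (Tagged (fun i => 'I_(X i)) j : K)).
  by rewrite [v ∘ q i](cotuplingE HP) [LHS](cotuplingE (HT (X i))).
have uv : u ∘ v = idm (op_cat T) P.
  apply: (coproduct_ext HP) => i; rewrite ccomp1m.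
  apply: (coproduct_ext (HT (X i))) => j.
  rewrite -!ccompA [v ∘ _]ccompA vE.
  exact: (uE (Tagged (fun i => 'I_(X i)) j : K)).
move=> Z f.
pose h : hom D (G #|{: K}|) Z := cotupling (HG #|{: K}|)
  (fun r => f (tag (enum_val r)) ∘ fmap G (e (enum_val r))).
have hE (k : K) : h ∘ @fmap _ _ G 1 #|{: K}| (lpi T (enum_rank k)) =
    f (tag k) ∘ fmap G (e k).
  rewrite [LHS](cotuplingE (HG #|{: K}|)).
  by rewrite (congr1 (fun k => f (tag k) ∘ fmap G (e k)) (enum_rankK k)).
exists (h ∘ fmap G v); split.
  move=> i; apply: (coproduct_ext (HG (X i))) => j.
  rewrite -!ccompA -!fmapM ccompA vE.
  exact: (hE (Tagged (fun i => 'I_(X i)) j : K)).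
move=> g gE.
suff -> : h = g ∘ fmap G u by rewrite -ccompA -fmapM uv fmap1 ccompm1.
apply: (coproduct_ext (HG #|{: K}|)) => r.
rewrite -[r]enum_valK hE -ccompA -fmapM uE fmapM ccompA.
by rewrite gE.
Qed.

Lemma lmor_preserves (T T' : lawvere) (Phi : lawvere_mor T T') :
  preserves_finite_products (lmor_functor Phi).
Proof.
apply: (@powers_preserve T (op_cat T') (functor_op (lmor_functor Phi))) => n /=.
have -> : (fun k : 'I_n => lmap Phi (lpi T k)) = (fun k => lpi T' k).
  by apply: functional_extensionality_dep => k; rewrite lmap_pi.
exact: (lpow T' n).
Qed.

Definition Alg (T : lawvere) : category :=
  @full_sub (functor_cat T SET) (@preserves_finite_products T SET).

Lemma alg_precomp_preserves (T T' : lawvere) (Phi : lawvere_mor T T') (B : Alg T') :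
  preserves_finite_products (functor_comp (sval B) (lmor_functor Phi)).
Proof.
move=> n X P p HP; apply: (svalP B); exact: (@lmor_preserves _ _ Phi n X P p HP).
Qed.

Definition alg_precomp_map (T T' : lawvere) (Phi : lawvere_mor T T') (B C : Alg T')
    (u : hom (Alg T') B C) :
    natural (functor_comp (sval B) (lmor_functor Phi))
      (functor_comp (sval C) (lmor_functor Phi)) :=
  @Natural T SET (functor_comp (sval B) (lmor_functor Phi))
    (functor_comp (sval C) (lmor_functor Phi)) (fun n => ncomp u n)
    (fun n m s => ncompP u (lmap Phi s)).

Definition alg_precomp (T T' : lawvere) (Phi : lawvere_mor T T') :
  functor (Alg T') (Alg T).
Proof.
refine (@Functor (Alg T') (Alg T)
  (fun B => exist _ _ (@alg_precomp_preserves T T' Phi B)) (@alg_precomp_map T T' Phi) _ _).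
- by move=> B; apply: natural_eq.
- by move=> B C E v u; apply: natural_eq.
Defined.

Section Terms.
Variables (S : Type) (ar : S -> nat).

Inductive term (G : Type) : Type :=
| Var of G
| App (s : S) of ('I_(ar s) -> term G).

Fixpoint eval (G B : Type) (o : forall s, ('I_(ar s) -> B) -> B) (g : G -> B)
    (t : term G) : B :=
  match t with
  | Var x => g x
  | App s ts => o s (fun i => eval o g (ts i))
  end.
End Terms.

(* Equations are pairs of terms in the variables x_0, x_1, ... *)
Record variety := Variety {
  opsym : Type;
  arity : opsym -> nat;
  eqn : term arity nat -> term arity nat -> Prop
}.

Section Algebras.
Variable V : variety.

Record algebra := Algebra {
  carrier :> Type;
  aop : forall s : opsym V, ('I_(arity s) -> carrier) -> carrier;
  aopP : forall l r, @eqn V l r ->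
    forall g : nat -> carrier, eval aop g l = eval aop g r
}.

Record alg_hom (A B : algebra) := AlgHom {
  hfun :> A -> B;
  hfunP : forall s (a : 'I_(arity s) -> A), hfun (aop a) = aop (fun i => hfun (a i))
}.

Lemma alg_hom_eq (A B : algebra) (f g : alg_hom A B) : (forall a, f a = g a) -> f = g.
Proof.
case: f g => f fp [g gp] /= e.
have {}e : f = g by apply: functional_extensionality_dep.
by subst g; rewrite (Prop_irrelevance fp gp).
Qed.

Definition hom_id (A : algebra) : alg_hom A A :=
  @AlgHom A A (fun a => a) (fun _ _ => erefl).

Definition hom_comp (A B C : algebra) (g : alg_hom B C) (f : alg_hom A B) :
  alg_hom A C.
Proof.
refine (@AlgHom A C (fun a => g (f a)) _).
by move=> s a; rewrite !hfunP.
Defined.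

Definition variety_cat : category.
Proof.
refine (@Category algebra (@CatOn algebra alg_hom hom_id hom_comp _ _ _)).
- by move=> *; apply: alg_hom_eq.
- by move=> *; apply: alg_hom_eq.
- by move=> *; apply: alg_hom_eq.
Defined.

(* The algebra presented by generators G and relations R: its elements are the
   classes, encoded as predicates on terms, of the least congruence containing
   R and all substitution instances of the equations of V. *)
Section Presentation.
Variables (G : Type) (R : term (@arity V) G -> term (@arity V) G -> Prop).

Inductive cong : term (@arity V) G -> term (@arity V) G -> Prop :=
| cong_refl t : cong t t
| cong_sym t u : cong t u -> cong u t
| cong_trans t u v : cong t u -> cong u v -> cong t v
| cong_app s ts us : (forall i, cong (ts i) (us i)) -> cong (@App _ _ _ s ts) (App us)
| cong_eqn l r g : @eqn V l r ->
    cong (eval (@App _ (@arity V) G) g l) (eval (@App _ (@arity V) G) g r)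
| cong_rel t u : R t u -> cong t u.

Definition pcarrier := {K : term (@arity V) G -> Prop | exists t, K = cong t}.

Definition cls (t : term (@arity V) G) : pcarrier :=
  exist _ (cong t) (ex_intro _ t erefl).

Definition rep (c : pcarrier) : term (@arity V) G := projT1 (cid (svalP c)).

Lemma clsP t u : cong t u -> cls t = cls u.
Proof.
move=> tu; rewrite /cls; apply: eq_exist.
apply: functional_extensionality_dep => v; apply: propositional_extensionality.
split; last exact: cong_trans.
by apply: cong_trans; apply: cong_sym.
Qed.

Lemma repK c : cls (rep c) = c.
Proof.
rewrite /rep; case: cid => t; case: c => K HK /= E.
by rewrite /cls; apply: eq_exist.
Qed.

Lemma cong_rep t : cong (rep (cls t)) t.
Proof.
have /(congr1 sval) /= -> := repK (cls t); exact: cong_refl.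
Qed.

Definition pop s (c : 'I_(arity s) -> pcarrier) : pcarrier :=
  cls (App (fun i => rep (c i))).

Lemma popE s (ts : 'I_(arity s) -> term (@arity V) G) :
  pop (fun i => cls (ts i)) = cls (App ts).
Proof. by apply: clsP; apply: cong_app => i; apply: cong_rep. Qed.

Lemma pop_eval (H : Type) (g : H -> term (@arity V) G) t :
  eval pop (fun x => cls (g x)) t = cls (eval (@App _ (@arity V) G) g t).
Proof.
elim: t => //= s ts IH; rewrite -popE; congr pop.
exact: functional_extensionality_dep.
Qed.

Lemma popP l r : @eqn V l r ->
  forall g : nat -> pcarrier, eval pop g l = eval pop g r.
Proof.
move=> lr g.
have -> : g = (fun x => cls (rep (g x))).
  by apply: functional_extensionality_dep => x; rewrite repK.
by rewrite !pop_eval; apply: clsP; apply: cong_eqn.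
Qed.

Definition presented : algebra := Algebra popP.

Definition pgen (x : G) : presented := cls (Var (@arity V) x).

Section Extension.
Variables (B : algebra) (g : G -> B).
Hypothesis gP : forall t u, R t u -> eval (@aop B) g t = eval (@aop B) g u.

Lemma eval_cong t u : cong t u -> eval (@aop B) g t = eval (@aop B) g u.
Proof.
elim=> {t u} //=.
- by move=> t u v _ -> _ ->.
- move=> s ts us _ IH; congr aop; exact: functional_extensionality_dep.
- move=> l r th lr.
  have E t : eval (@aop B) g (eval (@App _ (@arity V) G) th t) =
      eval (@aop B) (fun x => eval (@aop B) g (th x)) t.
    elim: t => //= s ts IH; congr aop; exact: functional_extensionality_dep.
  by rewrite !E; apply: aopP.
Qed.

Definition pext : alg_hom presented B.
Proof.
refine (@AlgHom presented B (fun c => eval (@aop B) g (rep c)) _).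
by move=> s a /=; rewrite (eval_cong (cong_rep _)).
Defined.

Lemma pextE x : pext (pgen x) = g x.
Proof. by rewrite /= (eval_cong (cong_rep _)). Qed.

End Extension.

Lemma presented_ext (B : algebra) (f h : alg_hom presented B) :
  (forall x, f (pgen x) = h (pgen x)) -> f = h.
Proof.
move=> fh; apply: alg_hom_eq => c; rewrite -(repK c).
elim: (rep c) => [x|s ts IH]; first exact: fh.
rewrite -popE; change (f (@aop presented s (fun i => cls (ts i))) =
  h (@aop presented s (fun i => cls (ts i)))).
rewrite !hfunP; congr aop; exact: functional_extensionality_dep.
Qed.

End Presentation.

Definition free (X : Type) : algebra := @presented X (fun _ _ => False).

Definition eta (X : Type) (x : X) : free X := pgen _ x.

Definition free_ext (X : Type) (B : algebra) (g : X -> B) : alg_hom (free X) B :=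
  @pext X (fun _ _ => False) B g (fun t u (H : False) => False_ind _ H).

Lemma free_extE (X : Type) (B : algebra) (g : X -> B) x : free_ext g (eta x) = g x.
Proof. exact: pextE. Qed.

Lemma free_hom_ext (X : Type) (B : algebra) (f h : alg_hom (free X) B) :
  (forall x, f (eta x) = h (eta x)) -> f = h.
Proof. exact: presented_ext. Qed.

Lemma free_ext_eq (X : Type) (B : algebra) (g h : X -> B) (w : free X) :
  (forall x, g x = h x) -> free_ext g w = free_ext h w.
Proof. by move=> e; congr (hfun (free_ext _) _); apply: functional_extensionality_dep. Qed.

Lemma free_ext_comp (X : Type) (B C : algebra) (k : alg_hom B C) (g : X -> B) (w : free X) :
  k (free_ext g w) = free_ext (fun x => k (g x)) w.
Proof.
have -> // : free_ext (fun x => k (g x)) = hom_comp k (free_ext g).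
apply: free_hom_ext => x; rewrite free_extE.
by apply: (f_equal k); rewrite free_extE.
Qed.

Lemma free_ext_hom (X : Type) (B : algebra) (h : alg_hom (free X) B) (w : free X) :
  free_ext (fun x => h (eta x)) w = h w.
Proof.
have -> // : free_ext (fun x => h (eta x)) = h.
by apply: free_hom_ext => x; rewrite free_extE.
Qed.

Definition free_functor : functor SET variety_cat.
Proof.
refine (@Functor SET variety_cat free
  (fun X Y f => free_ext (fun x : X => eta (f x))) _ _).
- by move=> X; apply: free_hom_ext => x; rewrite free_extE.
- move=> X Y Z g f; apply: free_hom_ext => x.
  rewrite free_extE; symmetry; rewrite -[RHS](free_extE (fun y => eta (g y))).
  by apply: (f_equal (free_ext _)); rewrite free_extE.
Defined.

Inductive copow_rel (X : Type) (A : algebra) :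
    term (@arity V) (X * A) -> term (@arity V) (X * A) -> Prop :=
| CopowRel x s (a : 'I_(arity s) -> A) :
    copow_rel (App (fun i => Var (@arity V) (x, a i))) (Var (@arity V) (x, aop a)).

Definition copow (X : Type) (A : algebra) : algebra := presented (@copow_rel X A).

Definition copow_in (X : Type) (A : algebra) (x : X) : alg_hom A (copow X A).
Proof.
refine (@AlgHom A (copow X A) (fun a => pgen (@copow_rel X A) (x, a)) _).
move=> s a; symmetry; rewrite /pgen.
change (@pop (X * A) (@copow_rel X A) s (fun i => cls _ (Var _ (x, a i))) =
  cls (@copow_rel X A) (Var _ (x, aop a))).
by rewrite popE; apply: clsP; apply: cong_rel.
Defined.

Lemma copow_coproduct (X : Type) (A : algebra) :
  @is_coproduct variety_cat X (fun=> A) (copow X A) (@copow_in X A).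
Proof.
move=> Z f.
have fP t u : @copow_rel X A t u ->
    eval (@aop Z) (fun xa : X * A => hfun (f xa.1) xa.2) t =
    eval (@aop Z) (fun xa : X * A => hfun (f xa.1) xa.2) u.
  by case=> x s a /=; rewrite hfunP.
exists (pext fP); split.
  by move=> x; apply: alg_hom_eq => a; exact: (pextE fP (x, a)).
move=> h hE; apply: presented_ext => -[x a].
by rewrite pextE /= -hE.
Qed.

(* The 1-fold copower of A is chosen to be A itself, so that the coalgebra
   functor_N A below has underlying algebra A on the nose. *)
Definition ncopow (n : nat) (A : algebra) : algebra :=
  match n with 1 => A | _ => copow 'I_n A end.

Definition ncopow_in (n : nat) (A : algebra) : 'I_n -> alg_hom A (ncopow n A) :=
  match n return 'I_n -> alg_hom A (ncopow n A) with
  | 0 => fun k => copow_in A k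
  | 1 => fun=> hom_id A
  | _.+2 => fun k => copow_in A k
  end.

Lemma ncopow_coproduct (n : nat) (A : algebra) :
  @is_coproduct variety_cat 'I_n (fun=> A) (ncopow n A) (@ncopow_in n A).
Proof.
case: n => [|[|n]]; try exact: copow_coproduct.
move=> Z f; exists (f ord0); split=> [i|h hE].
  by rewrite (ord1 i); apply: ccompm1.
by rewrite -(hE ord0); apply: ccompm1.
Qed.

Lemma free_coproduct (n : nat) :
  @is_coproduct variety_cat 'I_n (fun=> free 'I_1) (free 'I_n)
    (fun k => free_ext (fun=> eta k)).
Proof.
move=> Z f; exists (free_ext (fun k => hfun (f k) (eta ord0))); split.
  move=> k; apply: free_hom_ext => x; rewrite (ord1 x).
  rewrite -[RHS](free_extE (fun k => hfun (f k) (eta ord0))).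
  by apply: (f_equal (free_ext _)); rewrite free_extE.
move=> h hE; apply: free_hom_ext => k; rewrite free_extE -(hE k).
by apply: (f_equal h); rewrite free_extE.
Qed.

Definition theory_str : cat_on nat.
Proof.
refine (@CatOn nat (fun n m => alg_hom (free 'I_m) (free 'I_n))
  (fun n => hom_id (free 'I_n)) (fun n m p t s => hom_comp s t) _ _ _).
- by move=> *; apply: alg_hom_eq.
- by move=> *; apply: alg_hom_eq.
- by move=> *; apply: alg_hom_eq.
Defined.

Lemma theory_pi1 : free_ext (fun=> eta ord0) = idm theory_str 1.
Proof. by apply: free_hom_ext => x; rewrite free_extE (ord1 x). Qed.

(* The dual of the full subcategory of the variety on the free algebras F n:
   a morphism n -> m is a homomorphism F m -> F n, and the projections n -> 1
   are the coproduct injections F 1 -> F n. *)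
Definition theory : lawvere :=
  @Lawvere theory_str (fun n k => free_ext (fun=> eta k))
    (fun n Z f => @free_coproduct n (free 'I_Z) f) theory_pi1.

(* An operation s : n -> 1 of the theory is a homomorphism F 1 -> F n, that is,
   the element of F n to which s sends the generator. *)
Definition interp (n : nat) (s : hom theory n 1) (B : algebra) (b : 'I_n -> B) : B :=
  free_ext b (hfun s (eta ord0)).

Definition theory_incl : functor (op_cat theory) variety_cat :=
  @Functor (op_cat theory) variety_cat (fun n => free 'I_n) (fun n m s => s)
    (fun=> erefl) (fun _ _ _ _ _ => erefl).

Lemma theory_incl_preserves : preserves_finite_coproducts theory_incl.
Proof. apply: powers_preserve => n; exact: free_coproduct. Qed.

End Algebras.

(* Objects are the functors T^op -> V preserving all finite coproducts,
   morphisms are all natural transformations. *)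
Definition Coalg (T : lawvere) (V : variety) : category :=
  @full_sub (functor_cat (op_cat T) (variety_cat V))
    (@preserves_finite_coproducts (op_cat T) (variety_cat V)).

Definition coalg_forget (T : lawvere) (V : variety) :
    functor (Coalg T V) (variety_cat V) :=
  @Functor (Coalg T V) (variety_cat V) (fun A => sval A 1)
    (fun A B u => ncomp u 1) (fun=> erefl) (fun _ _ _ _ _ => erefl).

Section CoalgPrecomp.
Variables (V : variety) (T T' : lawvere) (Phi : lawvere_mor T T').

Definition coalg_precomp_functor (A : Coalg T' V) :
    functor (op_cat T) (variety_cat V) :=
  functor_comp (sval A) (functor_op (lmor_functor Phi)).

Lemma coalg_precomp_preserves (A : Coalg T' V) :
  preserves_finite_coproducts (coalg_precomp_functor A).
Proof.
move=> n X P q HP; apply: (svalP A); exact: (@lmor_preserves _ _ Phi n X P q HP).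
Qed.

Definition coalg_precomp_map (A B : Coalg T' V) (u : hom (Coalg T' V) A B) :
    natural (coalg_precomp_functor A) (coalg_precomp_functor B) :=
  @Natural (op_cat T) (variety_cat V) (coalg_precomp_functor A)
    (coalg_precomp_functor B) (fun n => ncomp u n)
    (fun n m s => @ncompP _ _ _ _ u n m (lmap Phi s)).

Definition coalg_precomp : functor (Coalg T' V) (Coalg T V).
Proof.
refine (@Functor (Coalg T' V) (Coalg T V)
  (fun A => exist _ _ (@coalg_precomp_preserves A)) coalg_precomp_map _ _).
- by move=> A; apply: natural_eq.
- by move=> A B C v u; apply: natural_eq.
Defined.

End CoalgPrecomp.

Section Representable.
Variables (T : lawvere) (V : variety) (A : Coalg T V).

(* rep_functor A is the representable functor C |-> V(A(-), C). *)
Definition rep_obj (C : algebra V) : functor T SET.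
Proof.
refine (@Functor T SET (fun n => alg_hom (sval A n) C)
  (fun n m s f => hom_comp f (@fmap _ _ (sval A) m n s)) _ _).
- move=> n; apply: functional_extensionality_dep => f.
  by rewrite (fmap1 (sval A)); apply: alg_hom_eq.
- move=> n m p t s; apply: functional_extensionality_dep => f.
  by rewrite (fmapM (sval A) (s : hom (op_cat T) m n) (t : hom (op_cat T) p m));
    apply: alg_hom_eq.
Defined.

Lemma rep_obj_preserves C : preserves_finite_products (rep_obj C).
Proof.
move=> n X P p HP Z f.
have HA := svalP A n X P p HP.
pose h z := cotupling HA (fun i => f i z).
exists h; split.
  move=> i; apply: functional_extensionality_dep => z.
  exact: (cotuplingE HA).
move=> g gE; apply: functional_extensionality_dep => z.
apply: (coproduct_ext HA) => i; rewrite (cotuplingE HA).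
by rewrite -(gE i).
Qed.

Definition rep_map (B C : algebra V) (g : alg_hom B C) :
  natural (rep_obj B) (rep_obj C).
Proof.
refine (@Natural T SET (rep_obj B) (rep_obj C) (fun n f => hom_comp g f) _).
by move=> n m s; apply: functional_extensionality_dep => f; apply: alg_hom_eq.
Defined.

Definition rep_functor : functor (variety_cat V) (Alg T).
Proof.
refine (@Functor (variety_cat V) (Alg T)
  (fun C => exist _ (rep_obj C) (@rep_obj_preserves C)) rep_map _ _).
- move=> B; apply: natural_eq => n; apply: functional_extensionality_dep => f.
  exact: alg_hom_eq.
- move=> B C D g f; apply: natural_eq => n.
  apply: functional_extensionality_dep => h; exact: alg_hom_eq.
Defined.

End Representable.

(* B |-> V(F_V -, B), the canonical equivalence of V with Alg T_V. *)
Definition to_alg (V : variety) : functor (variety_cat V) (Alg (theory V)) :=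
  @rep_functor (theory V) V (exist _ (theory_incl V) (@theory_incl_preserves V)).

Definition Phi_star (T : lawvere) (V : variety) (Phi : lawvere_mor T (theory V)) :
    functor (variety_cat V) (Alg T) :=
  functor_comp (alg_precomp Phi) (to_alg V).

Section CoalgCopower.
Variables (T : lawvere) (V : variety) (A : Coalg T V).

Definition copow_map (X Y : Type) (B C : algebra V) (j : X -> Y)
    (f : alg_hom B C) : alg_hom (copow X B) (copow Y C) :=
  cotupling (@copow_coproduct V X B) (fun x => hom_comp (copow_in C (j x)) f).

Lemma copow_mapE (X Y : Type) (B C : algebra V) (j : X -> Y) (f : alg_hom B C) x :
  hom_comp (copow_map j f) (copow_in B x) = hom_comp (copow_in C (j x)) f.
Proof. exact: (cotuplingE (@copow_coproduct V X B)). Qed.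

Lemma copow_hom_ext (X : Type) (B C : algebra V) (f g : alg_hom (copow X B) C) :
  (forall x, hom_comp f (copow_in B x) = hom_comp g (copow_in B x)) -> f = g.
Proof. exact: (coproduct_ext (@copow_coproduct V X B)). Qed.

Lemma copow_map_id (X : Type) (B : algebra V) :
  copow_map (fun x : X => x) (hom_id B) = hom_id (copow X B).
Proof.
by apply: copow_hom_ext => x; rewrite copow_mapE; apply: alg_hom_eq.
Qed.

Lemma copow_map_comp (X Y Z : Type) (B C D : algebra V) (k : Y -> Z) (j : X -> Y)
    (g : alg_hom C D) (f : alg_hom B C) :
  copow_map (fun x => k (j x)) (hom_comp g f) = hom_comp (copow_map k g) (copow_map j f).
Proof.
apply: copow_hom_ext => x; rewrite copow_mapE.
transitivity (hom_comp (copow_map k g) (hom_comp (copow_map j f) (copow_in B x)));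
  last exact: alg_hom_eq.
rewrite copow_mapE.
transitivity (hom_comp (hom_comp (copow_map k g) (copow_in C (j x))) f);
  last exact: alg_hom_eq.
by rewrite copow_mapE; apply: alg_hom_eq.
Qed.

Definition coalg_copow_functor (X : Type) : functor (op_cat T) (variety_cat V).
Proof.
refine (@Functor (op_cat T) (variety_cat V) (fun n => copow X (sval A n))
  (fun n m s => copow_map (fun x => x) (@fmap _ _ (sval A) n m s)) _ _).
- by move=> n; rewrite fmap1; apply: copow_map_id.
- by move=> n m p t s; rewrite fmapM; apply: copow_map_comp.
Defined.

Lemma coalg_copow_preserves (X : Type) :
  preserves_finite_coproducts (coalg_copow_functor X).
Proof.
move=> n Y P q HP Z f.
have HA := svalP A n Y P q HP.
pose h := cotupling (@copow_coproduct V X (sval A P))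
  (fun x => cotupling HA (fun i => hom_comp (f i) (copow_in (sval A (Y i)) x))).
have key (g : alg_hom (copow X (sval A P)) Z) i x :
    hom_comp (hom_comp g (copow_map (fun x => x) (fmap (sval A) (q i))))
      (copow_in (sval A (Y i)) x) =
    hom_comp (hom_comp g (copow_in (sval A P) x)) (fmap (sval A) (q i)).
  transitivity (hom_comp g (hom_comp (copow_map (fun x => x) (fmap (sval A) (q i)))
    (copow_in (sval A (Y i)) x))); first exact: alg_hom_eq.
  by rewrite copow_mapE; apply: alg_hom_eq.
exists h; split.
  move=> i; apply: copow_hom_ext => x; rewrite [LHS]key.
  rewrite [hom_comp h _](cotuplingE (@copow_coproduct V X (sval A P))).
  exact: (cotuplingE HA).
move=> g gE; apply: copow_hom_ext => x.
rewrite [hom_comp h _](cotuplingE (@copow_coproduct V X (sval A P))).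
apply: (coproduct_ext HA) => i; rewrite (cotuplingE HA).
by rewrite -gE; exact: key.
Qed.

Definition coalg_copow (X : Type) : Coalg T V :=
  exist _ (coalg_copow_functor X) (@coalg_copow_preserves X).

Definition coalg_copow_map (X Y : Type) (j : X -> Y) :
  hom (Coalg T V) (coalg_copow X) (coalg_copow Y).
Proof.
refine (@Natural (op_cat T) (variety_cat V) (coalg_copow_functor X)
  (coalg_copow_functor Y) (fun n => copow_map j (hom_id (sval A n))) _).
move=> n m s; rewrite -[LHS]copow_map_comp -[RHS]copow_map_comp.
by congr copow_map; apply: alg_hom_eq.
Defined.

Definition coalg_copow_in (X : Type) (x : X) : hom (Coalg T V) A (coalg_copow X).
Proof.
refine (@Natural (op_cat T) (variety_cat V) (sval A) (coalg_copow_functor X)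
  (fun n => copow_in (sval A n) x) _).
by move=> n m s; symmetry; apply: copow_mapE.
Defined.

Lemma coalg_copow_coproduct (X : Type) :
  @is_coproduct (Coalg T V) X (fun=> A) (coalg_copow X) (@coalg_copow_in X).
Proof.
move=> Z f.
pose h n := cotupling (@copow_coproduct V X (sval A n)) (fun x => ncomp (f x) n).
have hE n x : hom_comp (h n) (copow_in (sval A n) x) = ncomp (f x) n.
  exact: (cotuplingE (@copow_coproduct V X (sval A n))).
have hP n m (s : hom (op_cat T) n m) : @ccomp _ (variety_cat V) _ _ _ (h m)
    (fmap (coalg_copow_functor X) s) = @ccomp _ (variety_cat V) _ _ _
    (fmap (sval Z) s) (h n).
  apply: copow_hom_ext => x.
  transitivity (hom_comp (h m) (hom_comp (fmap (coalg_copow_functor X) s)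
    (copow_in (sval A n) x))); first exact: alg_hom_eq.
  rewrite copow_mapE.
  transitivity (hom_comp (hom_comp (h m) (copow_in (sval A m) x)) (fmap (sval A) s));
    first exact: alg_hom_eq.
  rewrite hE [LHS](ncompP (f x)).
  transitivity (hom_comp (fmap (sval Z) s) (hom_comp (h n) (copow_in (sval A n) x)));
    last exact: alg_hom_eq.
  by rewrite hE.
exists (@Natural (op_cat T) (variety_cat V) (coalg_copow_functor X) (sval Z) h hP).
split; first by move=> x; apply: natural_eq => n; apply: hE.
move=> g gE; apply: natural_eq => n; apply: copow_hom_ext => x.
by rewrite [LHS]hE -(gE x).
Qed.

Definition coalg_copower : functor SET (Coalg T V).
Proof.
refine (@Functor SET (Coalg T V) coalg_copow coalg_copow_map _ _).
- by move=> X; apply: natural_eq => n; apply: copow_map_id.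
- move=> X Y Z k j; apply: natural_eq => n; rewrite /= -copow_map_comp.
  by congr copow_map; apply: alg_hom_eq.
Defined.

End CoalgCopower.

Definition cooperation (T : lawvere) (V : variety) (A : Coalg T V) (n : nat)
    (s : hom T n 1) : alg_hom (sval A 1) (sval A n) :=
  @fmap _ _ (sval A) 1 n s.

Definition V_Phi1 (T : lawvere) (V : variety) (Phi : lawvere_mor T (theory V)) :
    Coalg T V :=
  coalg_precomp V Phi (exist _ (theory_incl V) (@theory_incl_preserves V)).

Definition V_Phi (T : lawvere) (V : variety) (Phi : lawvere_mor T (theory V)) :
    functor SET (Coalg T V) :=
  coalg_copower (V_Phi1 Phi).

Section Commutative.
Variables (V : variety) (comV : commutative_theory (theory V)).

Lemma ltuple_eta (p q : nat) (f : 'I_q -> hom (theory V) p 1) k :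
  hfun (ltuple f) (eta V k) = hfun (f k) (eta V ord0).
Proof.
rewrite -(tuplingE (lpow (theory V) q) f k).
by apply: (f_equal (hfun _)); rewrite free_extE.
Qed.

Lemma interp_comp (B : algebra V) (p q : nat) (f : 'I_q -> hom (theory V) p 1)
    (o : hom (theory V) q 1) (b : 'I_p -> B) :
  interp (o ∘ ltuple f : hom (theory V) p 1) b = interp o (fun k => interp (f k) b).
Proof.
rewrite /interp -[LHS](free_ext_hom (hom_comp (free_ext b) (ltuple f))).
apply: (@free_ext_eq V) => k.
exact: (congr1 (free_ext b) (ltuple_eta f k)).
Qed.

Lemma interp_pi (B : algebra V) (n : nat) (k : 'I_n) (b : 'I_n -> B) :
  interp (lpi (theory V) k) b = b k.
Proof. by rewrite /interp /lpi free_extE free_extE. Qed.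

Lemma aop_exchange (B : algebra V) (s t : opsym V)
    (b : 'I_(arity s) -> 'I_(arity t) -> B) :
  aop (fun i => aop (fun j => b i j)) = aop (fun j => aop (fun i => b i j)).
Proof.
pose op (s : opsym V) : hom (theory V) (arity s) 1 :=
  free_ext (fun=> @aop V (free V 'I_(arity s)) s (@eta V _)).
have opE s' (c : 'I_(arity s') -> B) : interp (op s') c = aop c.
  rewrite /interp /op free_extE hfunP; congr aop.
  by apply: functional_extensionality_dep => i; rewrite free_extE.
pose w (ij : 'I_(arity s * arity t)) : B :=
  let p := enum_val (cast_ord (esym (mxvec_cast _ _)) ij) in b p.1 p.2.
have wE i j : w (mxvec_index i j) = b i j.
  by rewrite /w /mxvec_index cast_ordK enum_rankK.
have := congr1 (fun f : hom (theory V) (arity s * arity t) 1 => interp f w)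
  (comV (op s) (op t)).
rewrite !interp_comp !opE => E.
transitivity (aop (fun i : 'I_(arity s) => interp (op t ∘ lrow (theory V) _ i) w)).
  congr aop; apply: functional_extensionality_dep => i.
  rewrite interp_comp opE; congr aop; apply: functional_extensionality_dep => j.
  by rewrite interp_pi wE.
rewrite E; congr aop; apply: functional_extensionality_dep => j.
rewrite interp_comp opE; congr aop; apply: functional_extensionality_dep => i.
by rewrite interp_pi wE.
Qed.

(* [A, B], the subalgebra of the power B^|A| formed by the homomorphisms. *)
Definition hom_op (A B : algebra V) (s : opsym V)
  (f : 'I_(arity s) -> alg_hom A B) : alg_hom A B.
Proof.
refine (@AlgHom V A B (fun a => aop (fun i => f i a)) _).
move=> t a; rewrite -aop_exchange; congr aop.
by apply: functional_extensionality_dep => i; rewrite hfunP.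
Defined.

Lemma hom_op_eval (A B : algebra V) (G : Type) (g : G -> alg_hom A B) t a :
  hfun (eval (@hom_op A B) g t) a = eval (@aop V B) (fun x => hfun (g x) a) t.
Proof.
elim: t => //= s ts IH; congr aop; exact: functional_extensionality_dep.
Qed.

Lemma hom_op_eqn (A B : algebra V) l r : @eqn V l r ->
  forall g : nat -> alg_hom A B, eval (@hom_op A B) g l = eval (@hom_op A B) g r.
Proof.
by move=> lr g; apply: alg_hom_eq => a; rewrite !hom_op_eval; apply: aopP.
Qed.

Definition ihom (A B : algebra V) : algebra V := Algebra (@hom_op_eqn A B).

Definition ihom_post (A B C : algebra V) (g : alg_hom B C) :
  alg_hom (ihom A B) (ihom A C).
Proof.
refine (@AlgHom V (ihom A B) (ihom A C) (fun f => hom_comp g f) _).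
by move=> s f; apply: alg_hom_eq => a /=; rewrite hfunP.
Defined.

Definition ihom_pre (A B C : algebra V) (f : alg_hom A B) :
  alg_hom (ihom B C) (ihom A C).
Proof.
refine (@AlgHom V (ihom B C) (ihom A C) (fun g => hom_comp g f) _).
by move=> s g; apply: alg_hom_eq.
Defined.

Definition ihom_functor (A : algebra V) : functor (variety_cat V) (variety_cat V).
Proof.
refine (@Functor (variety_cat V) (variety_cat V) (ihom A) (@ihom_post A) _ _).
- by move=> B; apply: alg_hom_eq => f; apply: alg_hom_eq.
- by move=> B C D g f; apply: alg_hom_eq => h; apply: alg_hom_eq.
Defined.

(* functor_N A is the coalgebra representing [A, -]: under the bijections
   V(n.A, C) = [A, C]^n, the map n.A -> m.A induced by
   s = (s_1, .., s_n) : m -> n in T_V corresponds, by the Yoneda lemma, to the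
   n-tuple of values of the s_j in [A, m.A] at the injections
   nu_1, .., nu_m. *)
Definition N_map (A : algebra V) (n m : nat) (s : hom (theory V) m n) :
    alg_hom (ncopow n A) (ncopow m A) :=
  cotupling (@ncopow_coproduct V n A) (fun j : 'I_n =>
    interp (lpi (theory V) j ∘ s : hom (theory V) m 1)
      ((fun k => ncopow_in A k) : 'I_m -> ihom A (ncopow m A))).

Lemma N_mapE (A : algebra V) (n m : nat) (s : hom (theory V) m n) (j : 'I_n) :
  hom_comp (N_map A s) (ncopow_in A j) =
  free_ext ((fun k => ncopow_in A k) : 'I_m -> ihom A (ncopow m A))
    (hfun s (eta V j)).
Proof.
rewrite [LHS](cotuplingE (@ncopow_coproduct V n A)) /interp.
have -> // : hfun (lpi (theory V) j ∘ s : hom (theory V) m 1) (eta V ord0) =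
    hfun s (eta V j).
by apply: (f_equal (hfun s)); rewrite free_extE.
Qed.

Lemma ncopow_hom_ext (n : nat) (B C : algebra V) (f g : alg_hom (ncopow n B) C) :
  (forall k, hom_comp f (ncopow_in B k) = hom_comp g (ncopow_in B k)) -> f = g.
Proof. exact: (coproduct_ext (@ncopow_coproduct V n B)). Qed.

Definition N_functor (A : algebra V) : functor (op_cat (theory V)) (variety_cat V).
Proof.
refine (@Functor (op_cat (theory V)) (variety_cat V) (fun n => ncopow n A)
  (fun n m s => N_map A s) _ _).
- move=> n; apply: ncopow_hom_ext => j; rewrite N_mapE free_extE.
  exact: alg_hom_eq.
- move=> n m p t s; apply: ncopow_hom_ext => j; rewrite N_mapE.
  transitivity (hom_comp (N_map A t) (hom_comp (N_map A s) (ncopow_in A j)));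
    last exact: alg_hom_eq.
  rewrite N_mapE -[RHS]/(hfun (ihom_post A (N_map A t)) _) free_ext_comp.
  rewrite -[LHS](free_ext_hom (hom_comp (free_ext _) t)).
  apply: (@free_ext_eq V 'I_m (ihom A (ncopow p A))) => k.
  by rewrite -[RHS]/(hom_comp _ _) N_mapE.
Defined.

Lemma N_functor_preserves (A : algebra V) :
  preserves_finite_coproducts (N_functor A).
Proof.
apply: powers_preserve => n /=.
have -> : (fun k : 'I_n => N_map A (lpi (theory V) k)) = (fun k => ncopow_in A k).
  apply: functional_extensionality_dep => k.
  transitivity (hom_comp (N_map A (lpi (theory V) k)) (@ncopow_in V 1 A ord0)).
    exact: alg_hom_eq.
  by rewrite N_mapE /lpi free_extE free_extE.
exact: ncopow_coproduct.
Qed.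

Definition N_obj (A : algebra V) : Coalg (theory V) V :=
  exist _ (N_functor A) (@N_functor_preserves A).

Definition N_hom_map (A B : algebra V) (f : alg_hom A B) (n : nat) :
    alg_hom (ncopow n A) (ncopow n B) :=
  cotupling (@ncopow_coproduct V n A) (fun k => hom_comp (ncopow_in B k) f).

Lemma N_hom_mapE (A B : algebra V) (f : alg_hom A B) n k :
  hom_comp (N_hom_map f n) (ncopow_in A k) = hom_comp (ncopow_in B k) f.
Proof. exact: (cotuplingE (@ncopow_coproduct V n A)). Qed.

Definition N_hom (A B : algebra V) (f : alg_hom A B) :
  hom (Coalg (theory V) V) (N_obj A) (N_obj B).
Proof.
refine (@Natural (op_cat (theory V)) (variety_cat V) (N_functor A) (N_functor B)
  (N_hom_map f) _).
move=> n m s; apply: ncopow_hom_ext => j.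
transitivity (hom_comp (N_hom_map f m) (hom_comp (N_map A s) (ncopow_in A j)));
  first exact: alg_hom_eq.
transitivity (hom_comp (N_map B s) (hom_comp (N_hom_map f n) (ncopow_in A j)));
  last exact: alg_hom_eq.
rewrite N_mapE N_hom_mapE.
transitivity (hom_comp (hom_comp (N_map B s) (ncopow_in B j)) f);
  last exact: alg_hom_eq.
rewrite N_mapE -[LHS]/(hfun (ihom_post A (N_hom_map f m)) _).
rewrite -[RHS]/(hfun (ihom_pre _ f) _) !free_ext_comp.
apply: (@free_ext_eq V 'I_m (ihom A (ncopow m B))) => k.
exact: N_hom_mapE.
Defined.

Definition functor_N : functor (variety_cat V) (Coalg (theory V) V).
Proof.
refine (@Functor (variety_cat V) (Coalg (theory V) V) N_obj N_hom _ _).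
- move=> A; apply: natural_eq => n; apply: ncopow_hom_ext => k.
  by rewrite [LHS]N_hom_mapE; apply: alg_hom_eq.
- move=> A B C g f; apply: natural_eq => n; apply: ncopow_hom_ext => k.
  rewrite [LHS]N_hom_mapE.
  transitivity (hom_comp (N_hom_map g n) (hom_comp (N_hom_map f n) (ncopow_in A k)));
    last exact: alg_hom_eq.
  rewrite N_hom_mapE.
  transitivity (hom_comp (hom_comp (N_hom_map g n) (ncopow_in B k)) f);
    last exact: alg_hom_eq.
  by rewrite N_hom_mapE; apply: alg_hom_eq.
Defined.

Definition N_Phi (T : lawvere) (Phi : lawvere_mor T (theory V)) :
    functor (variety_cat V) (Coalg T V) :=
  functor_comp (coalg_precomp V Phi) functor_N.

End Commutative.

(* Main.v *)
Require Import Defs.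
From mathcomp Require Import all_boot.
From mathcomp Require Import boolp.

(** A coalgebra sends T_n to the n-fold copower of its underlying algebra, so a
morphism of coalgebras is the same as a homomorphism f of the underlying
algebras compatible with all co-operations, and it is invertible as soon as f
is (coalg_hom_ext, coalg_hom_lift, coalg_iso).  All four parts of the theorem
reduce to this remark and to one formula (N_map_in): the action of N A on a
morphism of the theory is term evaluation at the injections
nu_k : A -> n.A.  The reason is that evaluation at an element a is a
homomorphism [A, B] -> B, so interpretation in [A, B] is computed pointwise.

Full faithfulness: every coalgebra morphism N_Phi A -> N_Phi B is N_Phi of its
component at T_1, since that component alone determines it.

Free algebras: each x in X gives a coalgebra morphism V_Phi(1) -> N_Phi(F X),
namely n-ary terms evaluated at the copies nu_k(x); together they define
V_Phi(X) -> N_Phi(F X), which on underlying algebras is the isomorphism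
X.F1 = F X.

Correspondence: given S with an isomorphism b : id = ||S||, the coalgebra S(F1)
has S(F1)(T_n) = n.F1 = F n, so transporting the action of S(F1) along these
isomorphisms (theta) gives Phi.  For a in A, the homomorphism F1 -> A sending
the generator to a and naturality of S carry the comparison of co-operations
on S(A) back to S(F1), where it holds by construction; hence b lifts to an
isomorphism N_Phi = S.  Conversely, an isomorphism N_Phi = N_Psi has as its
component at T_1 a natural automorphism of the identity functor of V.  Being
natural, it commutes with every co-operation, so it cancels from the
compatibility equation, which leaves equal co-operations; on F1 these determine
Phi and Psi.

Representable functor: homomorphisms n.A -> C and F n -> [A, C] are both
n-tuples of homomorphisms A -> C. *)

Set Implicit Arguments.
Unset Strict Implicit.
Unset Printing Implicit Defensive.

Local Open Scope cat_scope.

(** * Natural isomorphisms *)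

Lemma natural_iso (C D : category) (F G : functor C D) (u : natural F G) :
  (forall a, is_iso (u a)) -> @is_iso (functor_cat C D) F G u.
Proof.
move=> uI; pose v a := projT1 (cid (uI a)).
have vP a : v a ∘ u a = idm D (F a) /\ u a ∘ v a = idm D (G a) := projT2 (cid (uI a)).
have vN a b (f : hom C a b) : v b ∘ fmap G f = fmap F f ∘ v a.
  have [vu _] := vP b; have [_ uv] := vP a.
  by rewrite -[fmap G f]ccompm1 -uv (ccompA _ _ (v a)) -ncompP !ccompA vu ccomp1m.
by exists (Natural vN); split; apply: natural_eq => a /=; case: (vP a).
Qed.

Lemma nat_iso_sym (C D : category) (F G : functor C D) :
  nat_iso F G -> nat_iso G F.
Proof.
case=> u /natural_iso[v [vu uv]]; exists v => a; exists (u a).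
by split; [have := congr1 (fun w => ncomp w a) uv | have := congr1 (fun w => ncomp w a) vu].
Qed.

Lemma nat_iso_trans (C D : category) (F G H : functor C D) :
  nat_iso F G -> nat_iso G H -> nat_iso F H.
Proof.
case=> u uI [v vI]; exists (nat_comp v u) => a /=.
have [u' [u'u uu']] := uI a; have [v' [v'v vv']] := vI a.
exists (u' ∘ v'); split.
  by rewrite ccompA -(ccompA _ v') v'v ccompm1.
by rewrite ccompA -(ccompA _ _ u') uu' ccompm1.
Qed.

(** * Morphisms of coalgebras *)

Section CoalgebraMorphisms.
Variables (T : lawvere) (V : variety).
Implicit Types A B : Coalg T V.

Lemma coalg_pow A n : @is_coproduct (variety_cat V) 'I_n (fun=> sval A 1) (sval A n)
  (fun k => @fmap _ _ (sval A) 1 n (lpi T k)).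
Proof. exact: (svalP A n (fun=> 1) n _ (lpow T n)). Qed.

Arguments coalg_pow : clear implicits.

(** Naturality at the projections fixes u on each copower injection
A(T_1) -> A(T_n). *)
Lemma coalg_hom_ext A B (u v : hom (Coalg T V) A B) :
  ncomp u 1 = ncomp v 1 -> u = v.
Proof.
move=> e; apply: natural_eq => n; apply: (coproduct_ext (coalg_pow A n)) => k.
by rewrite !ncompP e.
Qed.

(** A homomorphism compatible with the co-operations underlies a coalgebra
morphism.  Compatibility with s : n -> 1 refers to the n-fold copower of f,
which is described here as any g restricting to f along the injections, to
avoid choosing copowers. *)
Lemma coalg_hom_lift A B (f : hom (variety_cat V) (sval A 1) (sval B 1)) :
  (forall n (s : hom T n 1) (g : hom (variety_cat V) (sval A n) (sval B n)),
     (forall k, g ∘ @fmap _ _ (sval A) 1 n (lpi T k) =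
                @fmap _ _ (sval B) 1 n (lpi T k) ∘ f) ->
     g ∘ @fmap _ _ (sval A) 1 n s = @fmap _ _ (sval B) 1 n s ∘ f) ->
  exists u : hom (Coalg T V) A B, ncomp u 1 = f.
Proof.
move=> fP.
pose g n : hom (variety_cat V) (sval A n) (sval B n) :=
  cotupling (coalg_pow A n) (fun k => @fmap _ _ (sval B) 1 n (lpi T k) ∘ f).
have gE n k : g n ∘ @fmap _ _ (sval A) 1 n (lpi T k) =
    @fmap _ _ (sval B) 1 n (lpi T k) ∘ f.
  exact: (cotuplingE (coalg_pow A n)).
have gN n m (s : hom (op_cat T) n m) :
    g m ∘ fmap (sval A) s = fmap (sval B) s ∘ g n.
  apply: (coproduct_ext (coalg_pow A n)) => k.
  by rewrite -!ccompA gE -fmapM fP // fmapM -ccompA.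
exists (@Natural (op_cat T) (variety_cat V) (sval A) (sval B) g gN) => /=.
(* The projection T_1 -> T_1 is the identity, so the 1-fold copower of f is f. *)
have := gE 1 ord0; rewrite lpi1.
rewrite (fmap1 (sval A) (1 : op_cat T)) (fmap1 (sval B) (1 : op_cat T)).
by rewrite ccompm1 ccomp1m.
Qed.

Lemma coalg_iso A B (u : hom (Coalg T V) A B) :
  @is_iso (variety_cat V) (sval A 1) (sval B 1) (ncomp u 1) -> is_iso u.
Proof.
case=> v [vu uv]; suff un : forall n, is_iso (ncomp u n) by exact: (natural_iso un).
move=> n; pose w := cotupling (coalg_pow B n)
  (fun k => @fmap _ _ (sval A) 1 n (lpi T k) ∘ v).
have wE k : w ∘ @fmap _ _ (sval B) 1 n (lpi T k) =
    @fmap _ _ (sval A) 1 n (lpi T k) ∘ v.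
  exact: (cotuplingE (coalg_pow B n)).
exists w; split.
  apply: (coproduct_ext (coalg_pow A n)) => k.
  by rewrite -ccompA ncompP ccompA wE -ccompA vu ccomp1m ccompm1.
apply: (coproduct_ext (coalg_pow B n)) => k.
by rewrite -ccompA wE ccompA ncompP -ccompA uv ccomp1m ccompm1.
Qed.

End CoalgebraMorphisms.

Arguments coalg_pow {T V} A n.

(** * Co-operations of N A *)

Section InternalHom.
Variables (V : variety) (comV : commutative_theory (theory V)).

Definition ihom_ev (A B : algebra V) (a : A) : alg_hom (ihom comV A B) B :=
  @AlgHom V (ihom comV A B) B (fun f => hfun f a) (fun _ _ => erefl).

(** Operations of [A, B] are pointwise because evaluation at a is a
homomorphism. *)
Lemma free_ext_ihom (X : Type) (A B : algebra V) (g : X -> ihom comV A B)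
    (w : free V X) (a : A) :
  hfun (free_ext g w) a = free_ext (fun x => hfun (g x) a) w.
Proof. exact: (free_ext_comp (ihom_ev B a)). Qed.

(** On the j-th copy of A, the map N A (s) : n.A -> m.A evaluates the j-th
component of s, an m-ary term, at the m copies of a. *)
Lemma N_map_in (A : algebra V) n m (s : hom (theory V) m n) (j : 'I_n) (a : A) :
  hfun (N_map comV A s) (ncopow_in A j a) =
  free_ext (fun k => ncopow_in A k a) (hfun s (eta V j)).
Proof.
have /(congr1 (fun f : alg_hom _ _ => f a)) := N_mapE comV A s j.
by rewrite free_ext_ihom.
Qed.

Lemma N_map_op (A : algebra V) n (s : hom (theory V) n 1) (a : A) :
  hfun (N_map comV A s) a = interp s (fun k => ncopow_in A k a).
Proof. exact: (@N_map_in A 1 n s ord0 a). Qed.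

Lemma N_map_pi (A : algebra V) n (k : 'I_n) :
  N_map comV A (lpi (theory V) k) = ncopow_in A k.
Proof. by apply: alg_hom_eq => a; rewrite (@N_map_op A) interp_pi. Qed.

Lemma N_hom_map1 (A B : algebra V) (f : alg_hom A B) :
  N_hom_map f 1 = f.
Proof.
apply: alg_hom_eq => a.
exact: (congr1 (fun f : alg_hom _ _ => f a) (N_hom_mapE f (ord0 : 'I_1))).
Qed.

Section Phi.
Variables (T : lawvere) (Phi : lawvere_mor T (theory V)).

Lemma N_Phi_pi (A : algebra V) n (k : 'I_n) :
  @fmap _ _ (sval (N_Phi comV Phi A)) 1 n (lpi T k) = ncopow_in A k.
Proof. by rewrite /= lmap_pi N_map_pi. Qed.

(** * Full faithfulness, and N_Phi as a section of the forgetful functor *)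

Lemma N_Phi_faithful : faithful (N_Phi comV Phi).
Proof.
move=> A B f g /(f_equal (@fmap _ _ (coalg_forget T V) _ _)) /=.
by rewrite !N_hom_map1.
Qed.

Lemma N_Phi_full : full (N_Phi comV Phi).
Proof.
move=> A B u; exists (ncomp u 1); apply: coalg_hom_ext; exact: N_hom_map1.
Qed.

Lemma N_Phi_section :
  nat_iso (functor_comp (coalg_forget T V) (N_Phi comV Phi))
    (functor_id (variety_cat V)).
Proof.
unshelve eexists.
  refine (@Natural _ _ (functor_comp (coalg_forget T V) (N_Phi comV Phi))
    (functor_id (variety_cat V)) (fun A => hom_id A) _).
  by move=> A B f; apply: alg_hom_eq => a /=; rewrite N_hom_map1.
by move=> A; exists (hom_id A); split; apply: alg_hom_eq.
Qed.

(** * The representable functor of N_Phi A *)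

(** The bijection between homomorphisms n.A -> C and F n -> [A, C]: both are
n-tuples of homomorphisms A -> C. *)
Definition rep_N_map (A C : algebra V) n (f : alg_hom (ncopow n A) C) :
    alg_hom (free V 'I_n) (ihom comV A C) :=
  free_ext (fun k => hom_comp f (ncopow_in A k) : ihom comV A C).

Definition rep_N_nat (A C : algebra V) :
  natural (sval (rep_functor (N_Phi comV Phi A) C))
    (sval (functor_comp (Phi_star Phi) (ihom_functor comV A) C)).
Proof.
refine (@Natural T SET (sval (rep_functor (N_Phi comV Phi A) C))
    (sval (functor_comp (Phi_star Phi) (ihom_functor comV A) C))
    (fun n => @rep_N_map A C n) _).
move=> n m s; apply: functional_extensionality_dep => f.
apply: free_hom_ext => j; rewrite [LHS]free_extE; apply: alg_hom_eq => a.
transitivity (hfun f (hfun (N_map comV A (Phi _ _ s)) (ncopow_in A j a))) => //.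
rewrite N_map_in free_ext_comp; symmetry; exact: free_ext_ihom.
Defined.

Lemma rep_N_bij (A C : algebra V) n :
  @is_iso SET _ _ (@rep_N_map A C n).
Proof.
exists (fun g : alg_hom (free V 'I_n) (ihom comV A C) =>
  cotupling (@ncopow_coproduct V n A) (fun k => hfun g (eta V k))).
split; apply: functional_extensionality_dep => f /=.
  apply: ncopow_hom_ext => k.
  rewrite [LHS](cotuplingE (@ncopow_coproduct V n A)).
  exact: (free_extE (fun k => hom_comp f (ncopow_in A k) : ihom comV A C)).
apply: free_hom_ext => k; rewrite [LHS]free_extE.
exact: (cotuplingE (@ncopow_coproduct V n A)).
Qed.

Lemma rep_N_Phi (A : algebra V) :
  nat_iso (rep_functor (N_Phi comV Phi A))
    (functor_comp (Phi_star Phi) (ihom_functor comV A)).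
Proof.
unshelve eexists.
  refine (@Natural _ _ (rep_functor (N_Phi comV Phi A))
    (functor_comp (Phi_star Phi) (ihom_functor comV A)) (@rep_N_nat A) _).
  move=> B C g; apply: natural_eq => n; apply: functional_extensionality_dep => f.
  apply: free_hom_ext => k; rewrite [LHS]free_extE.
  transitivity (hom_comp g (hom_comp f (ncopow_in A k))); first exact: alg_hom_eq.
  apply: (f_equal (hfun (ihom_post comV A g))); symmetry; exact: free_extE.
move=> C; apply: (@natural_iso T SET) => n; exact: rep_N_bij.
Qed.

(** * N_Phi on free algebras *)

(** The copower X.V_Phi(1) is compared with N_Phi(F X) by its universal
property: the copy indexed by x is sent by evaluating terms at the elements
nu_k(x).  Only the component at T_1 has to be inverted, and that component
is the canonical map X.F1 -> F X. *)
Lemma V_Phi_free :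
  nat_iso (V_Phi Phi) (functor_comp (N_Phi comV Phi) (free_functor V)).
Proof.
(* For an element a of A, the coalgebra morphism V_Phi(1) -> N_Phi A that sends
   the generator of F1 to a. *)
pose vE n (A : algebra V) a : alg_hom (free V 'I_n) (ncopow n A) :=
  free_ext (fun k => ncopow_in A k a).
have vEE n A a k : hfun (vE n A a) (eta V k) = ncopow_in A k a by exact: free_extE.
have vP A a n m (s : hom (op_cat T) n m) : @ccomp _ (variety_cat V) _ _ _ (vE m A a)
    (fmap (sval (V_Phi1 Phi)) s) = @ccomp _ (variety_cat V) _ _ _
    (fmap (sval (N_Phi comV Phi A)) s) (vE n A a).
  apply: free_hom_ext => k; symmetry.
  transitivity (hfun (N_map comV A (Phi _ _ s)) (hfun (vE n A a) (eta V k))) => //.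
  by rewrite vEE N_map_in.
pose v A a : hom (Coalg T V) (V_Phi1 Phi) (N_Phi comV Phi A) :=
  @Natural (op_cat T) (variety_cat V) (sval (V_Phi1 Phi)) (sval (N_Phi comV Phi A))
    (fun n => vE n A a) (@vP A a).
pose u X : hom (Coalg T V) (V_Phi Phi X) (N_Phi comV Phi (free V X)) :=
  cotupling (@coalg_copow_coproduct T V (V_Phi1 Phi) X) (fun x => v _ (eta V x)).
have uE X x : hom_comp (ncomp (u X) 1) (copow_in (free V 'I_1) x) = vE 1 _ (eta V x).
  have E : u X ∘ coalg_copow_in (V_Phi1 Phi) x = v _ (eta V x).
    exact: (cotuplingE (@coalg_copow_coproduct T V (V_Phi1 Phi) X)).
  exact: (f_equal (@fmap _ _ (coalg_forget T V) _ _) E).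
have uN X Y (f : X -> Y) : u Y ∘ fmap (V_Phi Phi) (f : hom SET X Y) =
    fmap (N_Phi comV Phi) (fmap (free_functor V) (f : hom SET X Y)) ∘ u X.
  apply: coalg_hom_ext => /=; rewrite N_hom_map1; apply: copow_hom_ext => x.
  transitivity (hom_comp (ncomp (u Y) 1)
    (hom_comp (copow_map f (hom_id (free V 'I_1))) (copow_in (free V 'I_1) x))).
    exact: alg_hom_eq.
  rewrite copow_mapE.
  transitivity (hom_comp (hom_comp (ncomp (u Y) 1) (copow_in (free V 'I_1) (f x)))
    (hom_id (free V 'I_1))); first exact: alg_hom_eq.
  rewrite uE.
  transitivity (hom_comp (free_ext (fun x => eta V (f x)))
    (hom_comp (ncomp (u X) 1) (copow_in (free V 'I_1) x))); last exact: alg_hom_eq.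
  rewrite uE; apply: free_hom_ext => k; rewrite [LHS]vEE.
  transitivity (hfun (free_ext (fun x => eta V (f x)))
    (hfun (vE 1 _ (eta V x)) (eta V k))) => //.
  by rewrite vEE (ord1 k) [RHS]free_extE.
exists (@Natural SET (Coalg T V) (V_Phi Phi)
  (functor_comp (N_Phi comV Phi) (free_functor V)) u uN) => X.
apply: (@coalg_iso T V); rewrite /=.
exists (free_ext (fun x => copow_in (free V 'I_1) x (eta V ord0))); split.
  apply: copow_hom_ext => x.
  transitivity (hom_comp (free_ext (fun x => copow_in (free V 'I_1) x (eta V ord0)))
    (hom_comp (ncomp (u X) 1) (copow_in (free V 'I_1) x))); first exact: alg_hom_eq.
  rewrite uE; apply: free_hom_ext => k; rewrite (ord1 k).
  transitivity (hfun (free_ext (fun x => copow_in (free V 'I_1) x (eta V ord0)))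
    (hfun (vE 1 _ (eta V x)) (eta V ord0))) => //.
  by rewrite vEE [LHS]free_extE.
apply: free_hom_ext => x.
transitivity (hfun (ncomp (u X) 1) (hfun (free_ext
  (fun x => copow_in (free V 'I_1) x (eta V ord0))) (eta V x))) => //.
rewrite free_extE -(vEE 1 (free V X) (eta V x) ord0).
exact: (congr1 (fun f : alg_hom _ _ => f (eta V ord0)) (uE X x)).
Qed.

End Phi.

(** * Phi is determined by N_Phi *)

Lemma theory_mor_eq (T : lawvere) (Phi Psi : lawvere_mor T (theory V)) :
  (forall n (s : hom T n 1),
     hfun (Phi n 1 s) (eta V ord0) = hfun (Psi n 1 s) (eta V ord0)) ->
  Phi = Psi.
Proof.
move=> e.
have {}e n m (s : hom T n m) : Phi n m s = Psi n m s.
  apply: free_hom_ext => k.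
  have E (X : lawvere_mor T (theory V)) :
      hfun (X n m s) (eta V k) = hfun (X n 1 (lpi T k ∘ s)) (eta V ord0).
    rewrite lmapM lmap_pi; apply: (f_equal (hfun (X n m s))).
    by rewrite free_extE.
  by rewrite !E.
case: Phi Psi e => [f f1 fM fpi] [g g1 gM gpi] /= e.
have {}e : f = g.
  apply: functional_extensionality_dep => n; apply: functional_extensionality_dep => m.
  exact: functional_extensionality_dep (e n m).
subst g; congr LawvereMor; exact: Prop_irrelevance.
Qed.

(** The component at T_1 of an isomorphism N_Phi = N_Psi is a natural
automorphism b of the identity of V.  Its n-fold copower at A is its own
value at n.A, so compatibility with a co-operation reads
b sigma_Phi = sigma_Psi b = b sigma_Psi, and b cancels. *)
Lemma N_Phi_inj (T : lawvere) (Phi Psi : lawvere_mor T (theory V)) :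
  nat_iso (N_Phi comV Phi) (N_Phi comV Psi) -> Phi = Psi.
Proof.
case=> u uI; apply: theory_mor_eq => n s.
pose A := free V 'I_1; pose B := ncopow n A.
pose b (X : algebra V) : alg_hom X X := ncomp (u X) 1.
have bN (X Y : algebra V) (f : alg_hom X Y) x : b Y (f x) = f (b X x).
  have := f_equal (@fmap _ _ (coalg_forget T V) _ _) (ncompP u (f : hom (variety_cat V) X Y)).
  rewrite /= !N_hom_map1 => /(f_equal (fun f : alg_hom _ _ => f x)); exact.
have unE : ncomp (u A) n = b B.
  apply: (coproduct_ext (coalg_pow (N_Phi comV Phi A) n)) => k.
  rewrite (ncompP (u A)) !N_Phi_pi; apply: alg_hom_eq => x.
  by symmetry; exact: (bN A B).
have E : N_map comV A (Phi n 1 s) = N_map comV A (Psi n 1 s).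
  have [v [/(f_equal (@fmap _ _ (coalg_forget T V) _ _)) /= vu _]] := uI B.
  apply: alg_hom_eq => x.
  have bK y : ncomp v 1 (b B y) = y := f_equal (fun f : alg_hom _ _ => f y) vu.
  rewrite -[LHS]bK -[RHS]bK; apply: (f_equal (hfun (ncomp v 1))).
  rewrite [RHS]bN -unE.
  exact: (f_equal (fun f : alg_hom _ _ => f x)
    (@ncompP _ _ _ _ (u A) (1 : op_cat T) n s)).
(* Through n.F1 = F n, the co-operation of s at the generator of F1 becomes the
   element of F n that encodes s. *)
pose p : alg_hom B (free V 'I_n) := cotupling (@ncopow_coproduct V n A)
  (fun k => free_ext (fun=> eta V k)).
have pE (w : hom (theory V) n 1) : p (N_map comV A w (eta V ord0)) = hfun w (eta V ord0).
  rewrite (@N_map_op A) /interp free_ext_comp -[RHS](free_ext_hom (hom_id _)).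
  apply: free_ext_eq => k.
  transitivity (hom_comp p (ncopow_in A k) (eta V ord0)) => //.
  rewrite [hom_comp p _](cotuplingE (@ncopow_coproduct V n A)).
  exact: free_extE.
by rewrite -!pE E.
Qed.

(** * Every section of the forgetful functor is some N_Phi *)

Section TheoryMorphismOfSection.
Variables (T : lawvere) (S : functor (variety_cat V) (Coalg T V)).
Variable b : natural (functor_id (variety_cat V)) (functor_comp (coalg_forget T V) S).

Let F1 : algebra V := free V 'I_1.
Let SF1 : Coalg T V := S F1.
Let x0 : sval SF1 1 := hfun (ncomp b F1) (eta V ord0).

(** The comparison F n -> S(F1)(T_n): the n-fold copower of b at F1, followed
by the copower presentation of S(F1)(T_n). *)
Definition theta n : alg_hom (free V 'I_n) (sval SF1 n) :=
  free_ext (fun k => hfun (@fmap _ _ (sval SF1) 1 n (lpi T k)) x0).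

Lemma thetaE n k : theta n (eta V k) = hfun (@fmap _ _ (sval SF1) 1 n (lpi T k)) x0.
Proof. exact: free_extE. Qed.

Lemma theta1 : theta 1 = ncomp b F1.
Proof.
apply: free_hom_ext => k; rewrite (ord1 k) thetaE lpi1.
by rewrite (fmap1 (sval SF1) (1 : op_cat T)).
Qed.

Lemma theta_pi n (k : 'I_n) :
  hom_comp (theta n) (lpi (theory V) k) =
  hom_comp (@fmap _ _ (sval SF1) 1 n (lpi T k)) (theta 1).
Proof.
apply: free_hom_ext => i; rewrite (ord1 i) theta1.
transitivity (theta n (hfun (lpi (theory V) k) (eta V ord0))) => //.
by rewrite [X in theta n X]free_extE thetaE.
Qed.

Hypothesis bI : @is_iso (variety_cat V) _ _ (ncomp b F1).

Lemma theta_iso n : @is_iso (variety_cat V) _ _ (theta n).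
Proof.
case: bI => g [gb bg].
pose t := cotupling (coalg_pow SF1 n) (fun k => hom_comp (lpi (theory V) k) g).
have tE k : hom_comp t (@fmap _ _ (sval SF1) 1 n (lpi T k)) =
    hom_comp (lpi (theory V) k) g.
  exact: (cotuplingE (coalg_pow SF1 n)).
exists t; split.
  apply: free_hom_ext => k.
  transitivity (t (theta n (eta V k))) => //; rewrite thetaE.
  transitivity (hom_comp t (@fmap _ _ (sval SF1) 1 n (lpi T k)) x0) => //.
  rewrite tE.
  transitivity (hfun (lpi (theory V) k) (hom_comp g (ncomp b F1) (eta V ord0))) => //.
  by rewrite [hom_comp g _]gb [LHS]free_extE.
apply: (coproduct_ext (coalg_pow SF1 n)) => k.
rewrite -ccompA ccomp1m [_ ∘ fmap _ _]tE.
transitivity (hom_comp (hom_comp (theta n) (lpi (theory V) k)) g); first exact: alg_hom_eq.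
rewrite theta_pi theta1.
transitivity (hom_comp (@fmap _ _ (sval SF1) 1 n (lpi T k)) (hom_comp (ncomp b F1) g));
  first exact: alg_hom_eq.
by rewrite [hom_comp (ncomp b F1) g]bg; apply: alg_hom_eq.
Qed.

(** Phi is the action of S(F1) transported along the isomorphisms theta; it is
only ever used through the equation stated here. *)
Lemma theory_mor_of_section :
  exists Phi : lawvere_mor T (theory V), forall n m (s : hom T n m) w,
    theta n (hfun (Phi n m s) w) = hfun (@fmap _ _ (sval SF1) m n s) (theta m w).
Proof.
pose t n := projT1 (cid (theta_iso n)).
have tK n w : t n (theta n w) = w.
  have [tt _] := projT2 (cid (theta_iso n)).
  exact: (f_equal (fun f : alg_hom _ _ => f w) tt).
have thK n w : theta n (t n w) = w.
  have [_ tt] := projT2 (cid (theta_iso n)).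
  exact: (f_equal (fun f : alg_hom _ _ => f w) tt).
pose Phi n m (s : hom T n m) : hom (theory V) n m :=
  hom_comp (t n) (hom_comp (@fmap _ _ (sval SF1) m n s) (theta m)).
have PhiE n m (s : hom T n m) w :
    theta n (hfun (Phi n m s) w) = hfun (@fmap _ _ (sval SF1) m n s) (theta m w).
  exact: thK.
have inj n m (f g : hom (theory V) n m) :
    (forall w, theta n (hfun f w) = theta n (hfun g w)) -> f = g.
  by move=> e; apply: alg_hom_eq => w; rewrite -[LHS]tK e tK.
unshelve eexists.
  refine (@LawvereMor T (theory V) Phi _ _ _).
  - move=> n; apply: inj => w; rewrite PhiE.
    by rewrite (fmap1 (sval SF1) (n : op_cat T)).
  - move=> n m p r s; apply: inj => w; rewrite PhiE.
    rewrite (fmapM (sval SF1) (s : hom (op_cat T) m n) (r : hom (op_cat T) p m)).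
    transitivity (theta n (hfun (Phi n m s) (hfun (Phi m p r) w))) => //.
    by rewrite !PhiE.
  - move=> n k; apply: inj => w; rewrite PhiE.
    exact: (f_equal (fun f : alg_hom _ _ => f w) (esym (theta_pi k))).
exact: PhiE.
Qed.

End TheoryMorphismOfSection.

(** The given isomorphism b lifts to coalgebra morphisms N_Phi A -> S A.  Its
compatibility with co-operations at a : A is transported, along the
homomorphism F1 -> A that hits a, from the case of the generator of F1, where
it is the defining equation of Phi. *)
Lemma section_is_N_Phi (T : lawvere) (S : functor (variety_cat V) (Coalg T V)) :
  nat_iso (functor_comp (coalg_forget T V) S) (functor_id (variety_cat V)) ->
  exists Phi : lawvere_mor T (theory V), nat_iso (N_Phi comV Phi) S.
Proof.
move=> /nat_iso_sym[b bI].
have [Phi PhiE] := theory_mor_of_section (bI (free V 'I_1)).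
exists Phi.
have bN (X Y : algebra V) (f : alg_hom X Y) x :
    ncomp b Y (f x) = ncomp (fmap S (f : hom (variety_cat V) X Y)) 1 (ncomp b X x).
  exact: (f_equal (fun f : alg_hom _ _ => f x) (ncompP b (f : hom (variety_cat V) X Y))).
have uP (A : algebra V) : exists u : hom (Coalg T V) (N_Phi comV Phi A) (S A),
    ncomp u 1 = ncomp b A.
  apply: coalg_hom_lift => n s g gE; apply: alg_hom_eq => a.
  have {}gE k : g (ncopow_in A k a) =
      hfun (@fmap _ _ (sval (S A)) 1 n (lpi T k)) (ncomp b A a).
    have := gE k; rewrite N_Phi_pi.
    exact: (f_equal (fun f : alg_hom _ _ => f a)).
  transitivity (g (hfun (N_map comV A (Phi n 1 s)) a)) => //.
  rewrite N_map_op /interp free_ext_comp.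
  pose h : alg_hom (free V 'I_1) A := free_ext (fun=> a).
  have ha : h (eta V ord0) = a by exact: free_extE.
  pose Sh := fmap S (h : hom (variety_cat V) (free V 'I_1) A).
  have ShN m (r : hom T m 1) y : ncomp Sh m (hfun (@fmap _ _ (sval (S (free V 'I_1))) 1 m r) y)
      = hfun (@fmap _ _ (sval (S A)) 1 m r) (ncomp Sh 1 y).
    exact: (f_equal (fun f : alg_hom _ _ => f y) (@ncompP _ _ _ _ Sh (1 : op_cat T) m r)).
  transitivity (hfun (@fmap _ _ (sval (S A)) 1 n s) (ncomp b A a)) => //.
  rewrite -{2}ha bN -ShN -(theta1 b) -PhiE.
  rewrite -[RHS](free_ext_hom (hom_comp (ncomp Sh n) (theta b n))).
  apply: free_ext_eq => k; rewrite gE.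
  transitivity (ncomp Sh n (theta b n (eta V k))) => //.
  by rewrite thetaE ShN -bN ha.
pose u A := projT1 (cid (uP A)).
have uE A : ncomp (u A) 1 = ncomp b A := projT2 (cid (uP A)).
have uN (A B : algebra V) (f : hom (variety_cat V) A B) :
    u B ∘ fmap (N_Phi comV Phi) f = fmap S f ∘ u A.
  apply: coalg_hom_ext => /=; rewrite N_hom_map1 !uE.
  exact: (ncompP b f).
exists (@Natural (variety_cat V) (Coalg T V) (N_Phi comV Phi) S u uN) => A.
apply: (@coalg_iso T V); rewrite /= uE; exact: bI.
Qed.

End InternalHom.

Theorem theorem28 (T : lawvere) (V : variety) (comV : commutative_theory (theory V)) :
  (forall Phi : lawvere_mor T (theory V),
     full (N_Phi comV Phi) /\ faithful (N_Phi comV Phi))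
  /\
  (forall Phi : lawvere_mor T (theory V),
     nat_iso (functor_comp (N_Phi comV Phi) (free_functor V)) (V_Phi Phi) /\
     nat_iso (functor_comp (coalg_forget T V) (N_Phi comV Phi))
       (functor_id (variety_cat V)))
  /\
  (forall S : functor (variety_cat V) (Coalg T V),
     nat_iso (functor_comp (coalg_forget T V) S) (functor_id (variety_cat V)) ->
     exists! Phi : lawvere_mor T (theory V), nat_iso (N_Phi comV Phi) S)
  /\
  (forall (Phi : lawvere_mor T (theory V)) (A : algebra V),
     nat_iso (rep_functor (N_Phi comV Phi A))
       (functor_comp (Phi_star Phi) (ihom_functor comV A)) /\
     forall (n : nat) (sigma : hom T n 1),
       hfun (cooperation (N_Phi comV Phi A) sigma) =
       (fun a : A => interp (Phi n 1 sigma) (fun k : 'I_n => ncopow_in A k a))).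
Proof.
split; first by move=> Phi; split; [exact: N_Phi_full | exact: N_Phi_faithful].
split; first by move=> Phi; split;
  [apply: nat_iso_sym; exact: V_Phi_free | exact: N_Phi_section].
split.
  move=> S /section_is_N_Phi[Phi PhiS]; exists Phi; split=> // Psi PsiS.
  apply: N_Phi_inj; apply: nat_iso_trans PhiS _; exact: nat_iso_sym.
move=> Phi A; split; first exact: rep_N_Phi.
move=> n sigma; apply: functional_extensionality_dep => a; exact: N_map_op.
Qed.
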